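(* Let $\mathcal{H}$ be a complex Hilbert space, let $T\in\mathcal{B}(\mathcal{H})$ be generalized Drazin invertible with closed range, and let $T^{-}$ be a fixed inner inverse of $T$. Then $X=T^{-}TT^d$ is the unique operator $X\in\mathcal{B}(\mathcal{H})$ satisfying $$TX=P_{\mathcal{R}(T^dT),\,\mathcal{N}(T^dT)}\quad\text{and}\quad\mathcal{R}(X)\subset\mathcal{R}(T^{-}T).$$
   Context: $\mathcal{B}(\mathcal{H})$ is the space of bounded linear operators on $\mathcal{H}$; $\mathcal{R}(\cdot)$ and $\mathcal{N}(\cdot)$ denote range and null space. An operator $Q$ is quasinilpotent if $\|Q^n\|^{1/n}\to0$. $T\in\mathcal{B}(\mathcal{H})$ is generalized Drazin invertible if there is $X\in\mathcal{B}(\mathcal{H})$ with $XTX=X$, $TX=XT$ and $T-T^2X$ quasinilpotent; such an $X$ is unique and is denoted $T^d$. An inner inverse of $T$ is $T^{-}\in\mathcal{B}(\mathcal{H})$ with $TT^{-}T=T$ (one exists iff $\mathcal{R}(T)$ is closed). $P_{M,N}$ denotes the (not necessarily orthogonal) projector, i.e. bounded idempotent, with range $M$ and null space $N$; the equation $TX=P_{M,N}$ means that $TX$ is idempotent with range $M$ and null space $N$. *)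

(* Defs.v *)
From HB Require Import structures.
From mathcomp Require Import all_boot all_order all_algebra.
From mathcomp Require Import complex.
From mathcomp Require Import all_classical all_reals all_analysis.

Set Implicit Arguments.
Unset Strict Implicit.
Unset Printing Implicit Defensive.

Import Order.TTheory GRing.Theory Num.Theory.
Import numFieldNormedType.Exports.

Local Open Scope classical_set_scope.
Local Open Scope ring_scope.
Local Open Scope complex_scope.

(* The inner product is linear in the first and conjugate-linear in the second
   argument. *)
HB.mixin Record CompleteNormedModule_isHilbert (R : realType) H
    of CompleteNormedModule R[i] H := {
  inner : {dot H for @Num.conj R[i]} ;
  inner_norm : forall x : H, `|x| ^+ 2 = inner x x
}.

#[short(type="hilbertType")]
HB.structure Definition Hilbert (R : realType) :=
  { H of CompleteNormedModule R[i] H & CompleteNormedModule_isHilbert R H }.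

Section Operators.
Context {R : realType} {H : hilbertType R}.
Implicit Types (T X P Q f : H -> H) (M N : set H).

Definition bounded_operator f : Prop :=
  linear f /\ exists M : R, forall x, `|f x| <= M%:C * `|x|.

Definition null_space f : set H := f @^-1` [set 0].

(* The norm of H takes its values in R[i]; [complex.Re] recovers the
   underlying real number. *)
Definition operator_norm f : R :=
  sup [set complex.Re `|f x| | x in [set x : H | `|x| <= 1]].

Definition quasinilpotent Q : Prop :=
  operator_norm (iter n Q) `^ n%:R^-1 @[n --> \oo] --> (0 : R).

Definition gdrazin_inverse T X : Prop :=
  [/\ bounded_operator X, X \o T \o X = X, T \o X = X \o T
    & quasinilpotent (T \- (T \o T \o X))].

Definition inner_inverse T X : Prop :=
  bounded_operator X /\ T \o X \o T = T.

Definition is_projector P M N : Prop :=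
  [/\ bounded_operator P, P \o P = P, range P = M & null_space P = N].

End Operators.

(* Main.v *)
Require Import Defs.
From mathcomp Require Import all_boot all_order all_algebra.
From mathcomp Require Import complex.
From mathcomp Require Import all_classical all_reals all_analysis.

Import Order.TTheory GRing.Theory Num.Theory.
Import numFieldNormedType.Exports.

Local Open Scope classical_set_scope.
Local Open Scope ring_scope.

(** Since [T Tm T = T], the candidate satisfies [T (Tm T Td) = T Td = Td T], which is idempotent
    because [Td T Td = Td]. Conversely, a projector is determined by its range and null space
    ([is_projector_unique]), so every solution [X] has [T X = Td T]. As [Tm T] is idempotent, it
    fixes its range, which contains that of [X]; hence [X = Tm T X = Tm Td T = Tm T Td]. *)

Lemma bounded_operator_comp (R : realType) (H : hilbertType R) (f g : H -> H) :
  bounded_operator f -> bounded_operator g -> bounded_operator (f \o g).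
Proof.
move=> [flin [A fA]] [glin [B gB]]; split.
  by move=> a u v /=; rewrite glin flin.
(* The bound [A] may be negative when [H] is trivial; the absolute value makes multiplication by it
   monotone. *)
exists (`|A| * B) => x /=.
have A_ge0 : 0 <= (`|A|%:C)%C by rewrite lecR.
rewrite rmorphM -mulrA; apply: (le_trans (fA (g x))).
apply: (@le_trans _ _ ((`|A|%:C)%C * `|g x|)).
  by rewrite ler_wpM2r // lecR ler_norm.
by rewrite ler_wpM2l.
Qed.

(* [P x - x] lies in the common null space and [P x] in the common range, so
   [Q x = Q (P x) = P x]. *)
Lemma is_projector_unique (R : realType) (H : hilbertType R) (P Q : H -> H)
    (M N : set H) :
  is_projector P M N -> is_projector Q M N -> P = Q.
Proof.
move=> [[Plin _] PP rP nP] [[Qlin _] QQ rQ nQ]; apply/funext => x.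
have -> : P x = Q (P x).
  have : range Q (P x) by rewrite rQ -rP; exists x.
  by move=> [y _ <-]; rewrite -[RHS]/((Q \o Q) y) QQ.
have : null_space Q (-1 *: x + P x).
  rewrite nQ -nP /null_space /= Plin -[P (P x)]/((P \o P) x) PP.
  by rewrite scaleN1r addNr.
by rewrite /null_space /= Qlin scaleN1r addrC => /eqP; rewrite subr_eq0 => /eqP.
Qed.

Theorem proposition5 (R : realType) (H : hilbertType R) (T Td Tm : H -> H)
    (T_bounded : bounded_operator T)
    (T_gdrazin : gdrazin_inverse T Td)
    (T_closed_range : closed (range T))
    (T_inner : inner_inverse T Tm) :
  unique
    (fun X : H -> H =>
       [/\ bounded_operator X,
           is_projector (T \o X) (range (Td \o T)) (null_space (Td \o T))
         & range X `<=` range (Tm \o T)])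
    (Tm \o T \o Td).
Proof.
have [Td_bounded TdTTd TTd _] := T_gdrazin.
have [Tm_bounded TTmT] := T_inner.
have projTd : is_projector (Td \o T) (range (Td \o T)) (null_space (Td \o T)).
  split=> //; first exact: bounded_operator_comp.
  by rewrite -[LHS]/((Td \o T \o Td) \o T) TdTTd.
have TX : T \o (Tm \o T \o Td) = Td \o T.
  by rewrite -[LHS]/((T \o Tm \o T) \o Td) TTmT.
split.
  split.
  - by do 2![apply: bounded_operator_comp => //].
  - by rewrite TX.
  - by move=> _ [x _ <-]; exists (Td x).
move=> X [_ projX rX].
(* Commuting [T] and [Td] exposes [Td \o T], which is then replaced by [T \o X]; what remains is
   that [Tm \o T] fixes each [X x]. *)
rewrite -[LHS]/(Tm \o (T \o Td)) TTd.
rewrite -(is_projector_unique _ _ _ _ _ _ projX projTd).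
apply/funext => x.
have [y _ yX] : range (Tm \o T) (X x) by apply: rX; exists x.
rewrite -[LHS]/(Tm (T (X x))) -yX.
by rewrite -[LHS]/(Tm ((T \o Tm \o T) y)) TTmT.
Qed.
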